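(* Let $(\Omega,\mu)$ be a finite probability space, $r\ge1$, $\gamma_2>\gamma_1>0$, and let $d$ be a nonnegative integer with $d\le\frac12\log(\gamma_2/\gamma_1)$. Let $f\colon\Omega^n\to\mathbb{R}$ be both $(r,\gamma_1,d)$-$L_1$-global and $(r,\gamma_2,d)$-$L_2$-global. Set \[r'_d=\frac{\sqrt d}{\log^{1/2}(\gamma_2/\gamma_1)},\qquad \gamma'_d=\left(\frac{33r}{\sqrt d}\right)^d\gamma_1\log^{d/2}\!\left(\frac{\gamma_2}{\gamma_1}\right).\] Then $f^{=d}$ is $(r'_d,\gamma'_d)$-$L_2$-global.
   Context: Norms w.r.t. $\mu^n$; $\log$ natural; convention $(\cdot)^0=1$. For $i\in[n]$, $E_i$ averages over coordinate $i$ according to $\mu$, $L_i=I-E_i$, $E_S=\prod_{i\in S}E_i$, $L_S=\prod_{i\in S}L_i$; $f^{=T}=E_{[n]\setminus T}L_Tf$, $f^{=d}=\sum_{|T|=d}f^{=T}$. Derivative: $D_{S,x}g=(L_Sg)_{S\to x}$ with $h_{S\to x}(y)=h(x,y)$. For $p\ge1$, $g$ is $(r,\gamma,d)$-$L_p$-global if $\|D_{S,x}g\|_p\le r^{|S|}\gamma$ for all $S\subseteq[n]$ with $|S|\le d$ and all $x\in\Omega^S$; $g$ is $(r,\gamma)$-$L_2$-global if $\|D_{S,x}g\|_2\le r^{|S|}\gamma$ for all $S\subseteq[n]$ and $x\in\Omega^S$. *)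

(* Defs.v *)
From HB Require Import structures.
From mathcomp Require Import all_boot all_order all_algebra.
From mathcomp Require Import reals exp.
Set Implicit Arguments. Unset Strict Implicit. Unset Printing Implicit Defensive.
Import Order.TTheory GRing.Theory Num.Theory.
Local Open Scope ring_scope.

Section Defs.
Variables (R : realType) (Omega : finType) (mu : Omega -> R) (n : nat).

Notation pt := {ffun 'I_n -> Omega}.

Definition upd (y : pt) (i : 'I_n) (a : Omega) : pt :=
  [ffun j => if j == i then a else y j].

Definition Eop (i : 'I_n) (g : pt -> R) : pt -> R :=
  fun y => \sum_(a : Omega) mu a * g (upd y i a).

Definition Lop (i : 'I_n) (g : pt -> R) : pt -> R :=
  fun y => g y - Eop i g y.

Definition ES (S : {set 'I_n}) (g : pt -> R) : pt -> R :=
  foldr Eop g (enum S).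
Definition LS (S : {set 'I_n}) (g : pt -> R) : pt -> R :=
  foldr Lop g (enum S).

Definition fpart (T : {set 'I_n}) (f : pt -> R) : pt -> R :=
  ES (~: T) (LS T f).

Definition fdeg (d : nat) (f : pt -> R) : pt -> R :=
  fun y => \sum_(T : {set 'I_n} | #|T| == d) fpart T f y.

Definition merge (S : {set 'I_n}) (x y : pt) : pt :=
  [ffun j => if j \in S then x j else y j].

(* D_{S,x} g = (L_S g)_{S -> x}; represented as a function on Omega^n
   that does not depend on the coordinates in S (only x restricted to S
   matters). *)
Definition Dop (S : {set 'I_n}) (x : pt) (g : pt -> R) : pt -> R :=
  fun y => LS S g (merge S x y).

Definition mun (y : pt) : R := \prod_(i < n) mu (y i).

Definition norm1 (g : pt -> R) : R := \sum_(y : pt) mun y * `|g y|.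
Definition norm2 (g : pt -> R) : R :=
  Num.sqrt (\sum_(y : pt) mun y * (g y) ^+ 2).

Definition global1d (r gamma : R) (d : nat) (g : pt -> R) : Prop :=
  forall (S : {set 'I_n}) (x : pt), (#|S| <= d)%N ->
    norm1 (Dop S x g) <= r ^+ #|S| * gamma.

Definition global2d (r gamma : R) (d : nat) (g : pt -> R) : Prop :=
  forall (S : {set 'I_n}) (x : pt), (#|S| <= d)%N ->
    norm2 (Dop S x g) <= r ^+ #|S| * gamma.

Definition global2 (r gamma : R) (g : pt -> R) : Prop :=
  forall (S : {set 'I_n}) (x : pt),
    norm2 (Dop S x g) <= r ^+ #|S| * gamma.

End Defs.

(* Main.v *)
Require Import Defs.
From HB Require Import structures.
From mathcomp Require Import all_boot all_order all_algebra.
From mathcomp Require Import boolp reals sequences exp.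
From mathcomp Require Import ring lra zify.
Set Implicit Arguments. Unset Strict Implicit. Unset Printing Implicit Defensive.
Import Order.TTheory GRing.Theory Num.Theory.
Local Open Scope ring_scope.

(** Write [L = ln (gamma2 / gamma1)]. Since [D_{S,x} (f^{=d}) = (D_{S,x} f)^{=d-|S|}]
and derivatives of [f] are again global, everything reduces to the level-[d]
inequality [|f^{=d}|_2^2 <= gamma1^2 ((33 r)^2 L / d)^d], proved by strong
induction on [d]. The induction hypothesis makes all proper derivatives of
[g = f^{=d}] small; if [|g|_2] exceeded the claimed bound, [g] would be
[L_2]-global with radius of order [sqrt (d / L)] and [gamma = |g|_2].

For such a [g], take an integer [m] close to [L / d] and [rho^2 = 1 / (16 m)].
Replacing one coordinate at a time by a Hilbert-space direction gives
[|T_rho g|_2m^2m <= sum_S (2m)^{m|S|} E_x |D_{S,x} g|_2^2m], and globalness turns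
the right-hand side into [|g|_2^{2m-2} <(I + b L_1)...(I + b L_n) g, g>] with
[b <= 1], where [g] is an eigenvector of both [T_rho] and the last operator.
Then [|g|_2^2 = <f, g>], interpolation of [|f|_{(2m)'}] between [|f|_1] and [|f|_2],
and [exp (L / m) <= 4^d] contradict the assumed lower bound on [|g|_2]. *)

(** * Inequalities for weighted sums *)

Section WeightedSums.
Variables (R : realFieldType) (I : finType) (w : I -> R).
Hypothesis w_ge0 : forall i, 0 <= w i.

(** Lagrange's identity: the defect of the inequality is half a weighted double sum of the squares
    [(u i * v j - u j * v i) ^+ 2]. *)
Lemma wsum_cauchy_schwarz (u v : I -> R) :
  (\sum_i w i * (u i * v i)) ^+ 2 <=
  (\sum_i w i * u i ^+ 2) * (\sum_i w i * v i ^+ 2).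
Proof.
have : 0 <= \sum_i \sum_j w i * w j * (u i * v j - u j * v i) ^+ 2.
  by apply: sumr_ge0 => i _; apply: sumr_ge0 => j _; rewrite ?(sqr_ge0, mulr_ge0, w_ge0).
set A := \sum_i w i * u i ^+ 2; set B := \sum_i w i * v i ^+ 2.
set C := \sum_i w i * (u i * v i).
suff -> : \sum_i \sum_j w i * w j * (u i * v j - u j * v i) ^+ 2
   = A * B *+ 2 - C ^+ 2 *+ 2.
  by rewrite subr_ge0 lerMn2r.
transitivity (\sum_i (w i * u i ^+ 2 * B + w i * v i ^+ 2 * A
    - w i * (u i * v i) * C *+ 2)).
  apply: eq_bigr => i _; rewrite -mulrnAr /A /B /C -sumrMnl !mulr_sumr -big_split /= -sumrB.
  by apply: eq_bigr => j _; ring.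
rewrite sumrB big_split /= sumrMnl -!mulr_suml -/A -/B -/C; ring.
Qed.

End WeightedSums.

Lemma pow_tangent (R : realFieldType) (m : nat) (x t : R) : 0 <= x -> 0 <= t ->
  t ^+ m.+1 + m.+1%:R * t ^+ m * (x - t) <= x ^+ m.+1.
Proof.
move=> x0 t0; elim: m => [|m IH]; first by rewrite !expr1 expr0; lra.
rewrite (exprS x); apply: le_trans (ler_wpM2l x0 IH).
rewrite -subr_ge0.
suff -> : x * (t ^+ m.+1 + m.+1%:R * t ^+ m * (x - t)) -
   (t ^+ m.+2 + m.+2%:R * t ^+ m.+1 * (x - t)) = m.+1%:R * (t ^+ m * (x - t) ^+ 2).
  by rewrite ?(sqr_ge0, exprn_ge0, mulr_ge0).
by rewrite !exprS -[m.+2%:R]natr1; ring.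
Qed.

(** Jensen for total mass at most [B]: the tangents of [t ^+ m.+1] at [G] are summed at the points
    [B * g i], and the missing mass leaves the nonnegative defect [m%:R * G ^+ m.+1 * (B - P)]. *)
Lemma wsum_power_mean (R : realFieldType) (I : finType) (w : I -> R)
  (m : nat) (B : R) (g : I -> R) :
  (forall i, 0 <= w i) -> (forall i, 0 <= g i) -> \sum_i w i <= B ->
  0 < B ->
  (\sum_i w i * g i) ^+ m.+1 <= B ^+ m * \sum_i w i * g i ^+ m.+1.
Proof.
move=> w_ge0 g0 PB B0; set G := \sum_i w i * g i.
have G0 : 0 <= G by apply: sumr_ge0 => i _; rewrite mulr_ge0.
rewrite -(ler_pM2l B0) mulrA -exprS.
have : \sum_i w i * (G ^+ m.+1 + m.+1%:R * G ^+ m * (B * g i - G)) <=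
   \sum_i w i * (B * g i) ^+ m.+1.
  apply: ler_sum => i _; rewrite ler_wpM2l// pow_tangent// mulr_ge0// ltW//.
under [X in _ <= X]eq_bigr do rewrite exprMn mulrCA.
rewrite -mulr_sumr; apply: le_trans.
have -> : \sum_i w i * (G ^+ m.+1 + m.+1%:R * G ^+ m * (B * g i - G)) =
   (\sum_i w i) * G ^+ m.+1 + m.+1%:R * G ^+ m * (B * G - (\sum_i w i) * G).
  rewrite {4}/G !mulr_suml mulr_sumr -sumrB mulr_sumr -big_split /=.
  by apply: eq_bigr => i _; ring.
set P := \sum_i w i in PB *.
rewrite -subr_ge0.
suff -> : P * G ^+ m.+1 + m.+1%:R * G ^+ m * (B * G - P * G) - B * G ^+ m.+1
  = m%:R * G ^+ m.+1 * (B - P).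
  by rewrite ?(exprn_ge0, mulr_ge0) ?subr_ge0.
by rewrite -natr1 exprS; ring.
Qed.

(* Hoelder's inequality between [L_1], [L_2] and [L_2m], by Jensen for the
   measure [w |f|] and then Cauchy-Schwarz. *)
Lemma wsum_interpolation (R : realFieldType) (I : finType) (w : I -> R)
  (m : nat) (g1 : R) (f g : I -> R) :
  (forall i, 0 <= w i) -> 0 < g1 -> \sum_i w i * `|f i| <= g1 ->
  (\sum_i w i * (f i * g i)) ^+ (m.+1).*2 <=
  g1 ^+ m.*2 * (\sum_i w i * f i ^+ 2) * (\sum_i w i * g i ^+ (m.+1).*2).
Proof.
set F := \sum_i w i * (f i * g i) => w_ge0 g1_gt0 hf.
have hF : `|F| <= \sum_i (w i * `|f i|) * `|g i|.
  apply: le_trans (ler_norm_sum _ _ _) _; apply: ler_sum => i _.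
  by rewrite !normrM (ger0_norm (w_ge0 i)) mulrA.
have pm : `|F| ^+ m.+1 <= g1 ^+ m * \sum_i w i * (`|f i| * `|g i| ^+ m.+1).
  apply: le_trans (lerXn2r _ _ _ hF) _; rewrite ?nnegrE ?sumr_ge0//.
    by move=> i _; rewrite !mulr_ge0.
  under [X in _ <= _ * X]eq_bigr do rewrite mulrA.
  apply: (wsum_power_mean (w := fun i => w i * `|f i|)) => // i.
  by rewrite mulr_ge0.
rewrite -mul2n exprM -(real_normK (num_real F)) -exprM mulnC exprM.
apply: le_trans (lerXn2r _ _ _ pm) _; rewrite ?nnegrE ?exprn_ge0//
  ?mulr_ge0 ?exprn_ge0 ?(ltW g1_gt0) ?sumr_ge0//.
  by move=> i _; rewrite ?(exprn_ge0, mulr_ge0).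
rewrite exprMn -exprM muln2 -mulrA ler_wpM2l ?exprn_ge0 ?(ltW g1_gt0)//.
apply: le_trans (wsum_cauchy_schwarz w_ge0 _ _) _.
rewrite le_eqVlt; apply/orP; left; apply/eqP; congr (_ * _); apply: eq_bigr => i _.
  by rewrite real_normK ?num_real.
by rewrite -exprM muln2 -mul2n !exprM real_normK ?num_real.
Qed.

(** The induction multiplies by [A + s >= 0]; the difference of the two sides is then a nonnegative
    multiple of [(K + 1) * A - K ^+ 2 * s], which is nonnegative because [K * s <= A]. *)
Lemma bernoulli_upper (R : realFieldType) (k : nat) (A s : R) : 0 <= A -> - A <= k.+2%:R * s <= A ->
  (A + s) ^+ k.+2 <=
  A ^+ k.+2 + k.+2%:R * A ^+ k.+1 * s + k.+2%:R ^+ 2 * A ^+ k * s ^+ 2.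
Proof.
move=> A0; elim: k => [|k IH] /andP[hl hr].
  rewrite expr0 expr1.
  have := sqr_ge0 s; rewrite !expr2; lra.
have h0 : 0 <= A + s.
  have : 0 <= k.+3%:R :> R by [].
  have: 1 <= k.+3%:R :> R by rewrite ler1n.
  move: hl hr; set K := k.+3%:R; nra.
have hk : - A <= k.+2%:R * s <= A.
  have : 0 <= k.+2%:R :> R by [].
  move: hl hr; rewrite -[k.+3%:R]natr1; set K := k.+2%:R => *.
  apply/andP; split; nra.
rewrite exprS; apply: le_trans (ler_wpM2l h0 (IH hk)) _.
rewrite -subr_ge0.
set K := k.+2%:R in hk *.
have K0 : 0 <= K by [].
suff -> : A ^+ k.+3 + k.+3%:R * A ^+ k.+2 * s + k.+3%:R ^+ 2 * A ^+ k.+1 * s ^+ 2 -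
   (A + s) * (A ^+ k.+2 + K * A ^+ k.+1 * s + K ^+ 2 * A ^+ k * s ^+ 2)
  = A ^+ k * s ^+ 2 * ((K + 1) * A - K ^+ 2 * s).
  rewrite ?(sqr_ge0, exprn_ge0, mulr_ge0)// subr_ge0.
  move/andP: hk => [h1 h2]; rewrite expr2 -mulrA; nra.
by rewrite -[k.+3%:R]natr1 -/K !exprS; ring.
Qed.

Lemma ler_of_sqr (R : realDomainType) (x y : R) : 0 <= y -> x ^+ 2 <= y ^+ 2 -> - y <= x <= y.
Proof.
move=> y0 h; rewrite -ler_norml -(ler_pXn2r (n:=2))// ?nnegrE//.
by rewrite real_normK ?num_real.
Qed.

(** To be read with [A] and [U] the squared norms of [a] and [h], [p] equal to [rho] times their
    inner product, and [q = rho ^+ 2 * U]. The term linear in [p] is kept exactly, since it will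
    average to zero. *)
Lemma power_increment_le (R : realFieldType) (k : nat) (A U p q : R) :
  let K := k.+2%:R in
  0 <= A -> 0 <= U -> 0 <= q -> 16 * K * q <= U -> p ^+ 2 <= A * q ->
  (A + 2 * p + q) ^+ k.+2 <=
  A ^+ k.+2 + K * A ^+ k.+1 * (2 * p + U) + (2 * K * U) ^+ k.+2.
Proof.
move=> K A0 U0 q0 hq hp.
have K2 : 2 <= K by rewrite ler_nat.
have hpU : 16 * K * p ^+ 2 <= A * U.
  apply: le_trans (_ : A * (16 * K * q) <= _); last by rewrite ler_wpM2l.
  by rewrite (mulrCA A) ler_wpM2l// mulr_ge0//; lra.
have qU : 32 * q <= U by nra.
(* If [A] dominates [K * U], the increment is at most [A / K] in size and the second-order expansion
   applies. Otherwise [A + 2 * p + q] is at most [2 * K * U], so the last term alone suffices and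
   the other terms have nonnegative sum. *)
have [hA|hA] := lerP (K * U) A.
  have UA : 2 * U <= A by nra.
  have UU : U ^+ 2 * 2 <= A * U by nra.
  have hs : K ^+ 2 * (2 * p + q) ^+ 2 <= (K / 2 + 1/128) * (A * U).
    have h1 : (2 * p + q) ^+ 2 <= 8 * p ^+ 2 + 2 * q ^+ 2.
      by have := sqr_ge0 (2 * p - q); lra.
    have h2 : (K * q) ^+ 2 <= (U / 16) ^+ 2.
      by rewrite ler_pXn2r ?nnegrE//; [lra | nra | lra].
    have h3 : K ^+ 2 * p ^+ 2 <= K / 16 * (A * U).
      have : K * (16 * K * p ^+ 2) <= K * (A * U) by rewrite ler_wpM2l//; lra.
      lra.
    have : K ^+ 2 * (2 * p + q) ^+ 2 <= K ^+ 2 * (8 * p ^+ 2 + 2 * q ^+ 2).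
      by rewrite ler_wpM2l// sqr_ge0.
    have := mulr_ge0 A0 U0; lra.
  have hs' : - A <= K * (2 * p + q) <= A.
    apply: ler_of_sqr => //; rewrite exprMn; apply: le_trans hs _.
    have : K * U * A <= A * A by rewrite ler_wpM2r.
    have : U * A <= A * A by rewrite ler_wpM2r//; lra.
    have := mulr_ge0 A0 A0; rewrite expr2; lra.
  rewrite -addrA; apply: le_trans (bernoulli_upper A0 hs') _.
  apply: le_trans (_ : _ <= A ^+ k.+2 + K * A ^+ k.+1 * (2 * p + U)) _; last first.
    by rewrite lerDl exprn_ge0// mulr_ge0//; lra.
  rewrite -addrA lerD2l -/K -subr_ge0.
  suff -> : K * A ^+ k.+1 * (2 * p + U) - (K * A ^+ k.+1 * (2 * p + q) +
     K ^+ 2 * A ^+ k * (2 * p + q) ^+ 2) =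
     A ^+ k * (K * (A * U) - K * q * A - K ^+ 2 * (2 * p + q) ^+ 2).
    rewrite mulr_ge0 ?exprn_ge0//.
    have : 16 * (K * q) * A <= U * A by rewrite ler_wpM2r//; lra.
    have : 2 * (A * U) <= K * (A * U) by rewrite ler_wpM2r// mulr_ge0.
    have := mulr_ge0 A0 U0; lra.
  by rewrite exprS; ring.
have KU : 2 * U <= K * U by rewrite ler_wpM2r.
have hl : - (A + q) <= 2 * p <= A + q.
  apply: ler_of_sqr; first by rewrite addr_ge0.
  have := sqr_ge0 (A - q); lra.
have hu : - (U / 2) <= 2 * p <= U / 2.
  apply: ler_of_sqr; first by lra.
  have : A * U <= K * U * U by rewrite ler_wpM2r// ltW.
  have : 0 < K by lra.
  nra.
have hv : - (A + K * U) <= K * (2 * p) <= A + K * U.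
  apply: ler_of_sqr; first by lra.
  have : K * (16 * K * p ^+ 2) <= K * (A * U) by rewrite ler_wpM2l//; lra.
  have := sqr_ge0 (A - K * U).
  have : 0 <= K * (A * U) by rewrite !mulr_ge0//; lra.
  rewrite !expr2; lra.
apply: le_trans (_ : (2 * K * U) ^+ k.+2 <= _).
  by rewrite ler_pXn2r ?nnegrE//; lra.
rewrite lerDr.
suff -> : A ^+ k.+2 + K * A ^+ k.+1 * (2 * p + U) =
  A ^+ k.+1 * (A + K * (2 * p) + K * U).
  by rewrite mulr_ge0 ?exprn_ge0//; lra.
by rewrite exprS; ring.
Qed.

Lemma bernoulli_lower (R : realFieldType) (m : nat) (A U : R) : 0 <= A -> 0 <= U ->
  A ^+ m.+1 + m.+1%:R * A ^+ m * U <= (A + U) ^+ m.+1.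
Proof.
move=> A0 U0; have := @pow_tangent _ m (A + U) A (addr_ge0 A0 U0) A0.
by rewrite addrAC subrr add0r.
Qed.

(* The one-coordinate inequality, for functions [x |-> a + rho h_x] with values
   in the Hilbert space [L_2(w)]; in the tensorization this space absorbs the
   coordinates already treated. *)
Lemma hilbert_one_coordinate (R : realFieldType) (O Y : finType) (mu : O -> R)
  (w : Y -> R) (k : nat) (rho : R) (a : Y -> R) (h : O -> Y -> R) :
  let nrm (u : Y -> R) := \sum_y w y * u y ^+ 2 in
  (forall x, 0 <= mu x) -> \sum_x mu x = 1 -> (forall y, 0 <= w y) ->
  16 * k.+2%:R * rho ^+ 2 <= 1 ->
  (forall y, \sum_x mu x * h x y = 0) ->
  \sum_x mu x * nrm (fun y => a y + rho * h x y) ^+ k.+2 <=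
  (nrm a + \sum_x mu x * nrm (h x)) ^+ k.+2 +
  (2 * k.+2%:R) ^+ k.+2 * \sum_x mu x * nrm (h x) ^+ k.+2.
Proof.
move=> nrm mu0 mu1 w0 hrho h0.
pose t x := \sum_y w y * (a y * h x y).
have nrm0 u : 0 <= nrm u by apply: sumr_ge0 => y _; rewrite mulr_ge0 ?sqr_ge0.
have t0 : \sum_x mu x * t x = 0.
  under eq_bigr do rewrite mulr_sumr.
  rewrite exchange_big /= big1// => y _.
  under eq_bigr do rewrite mulrCA (mulrCA (mu _)) mulrA.
  by rewrite -mulr_sumr h0 mulr0.
have nrmE x : nrm (fun y => a y + rho * h x y) =
    nrm a + 2 * (rho * t x) + rho ^+ 2 * nrm (h x).
  rewrite /nrm /t !mulr_sumr -!big_split /=.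
  by apply: eq_bigr => y _; ring.
set A := nrm a.
apply: le_trans (_ : _ <= \sum_x mu x * (A ^+ k.+2 + k.+2%:R * A ^+ k.+1 *
   (2 * (rho * t x) + nrm (h x)) + (2 * k.+2%:R * nrm (h x)) ^+ k.+2)) _.
  apply: ler_sum => x _; rewrite ler_wpM2l// nrmE.
  apply: power_increment_le; rewrite ?(sqr_ge0, mulr_ge0)//.
  - by rewrite mulrA -[leRHS]mul1r ler_wpM2r.
  by rewrite exprMn (mulrCA A) ler_wpM2l ?sqr_ge0// wsum_cauchy_schwarz.
have -> : \sum_x mu x * (A ^+ k.+2 + k.+2%:R * A ^+ k.+1 *
   (2 * (rho * t x) + nrm (h x)) + (2 * k.+2%:R * nrm (h x)) ^+ k.+2) =
   A ^+ k.+2 + k.+2%:R * A ^+ k.+1 * (\sum_x mu x * nrm (h x))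
   + (2 * k.+2%:R) ^+ k.+2 * \sum_x mu x * nrm (h x) ^+ k.+2.
  transitivity (A ^+ k.+2 * (\sum_x mu x) +
     k.+2%:R * A ^+ k.+1 * 2 * rho * (\sum_x mu x * t x) +
     k.+2%:R * A ^+ k.+1 * (\sum_x mu x * nrm (h x))
   + (2 * k.+2%:R) ^+ k.+2 * \sum_x mu x * nrm (h x) ^+ k.+2).
    rewrite !mulr_sumr -!big_split /=; apply: eq_bigr => x _.
    rewrite (exprMn _ (2 * _)); ring.
  by rewrite mu1 t0 mulr1 mulr0 addr0.
(* What remains on the left is the start of the binomial expansion of the power on the right. *)
rewrite lerD2r; apply: bernoulli_lower; first exact: nrm0.
by apply: sumr_ge0 => x _; apply: mulr_ge0; [exact: mu0|exact: nrm0].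
Qed.

(** * Products of coordinate operators *)

Section Operators.
Variables (R : realType) (Omega : finType) (mu : Omega -> R) (n : nat).
Hypothesis mu_ge0 : forall a, 0 <= mu a.
Hypothesis mu_sum1 : \sum_(a : Omega) mu a = 1.

Notation pt := {ffun 'I_n -> Omega}.
Notation E_ := (@Eop R Omega mu n).
Notation L_ := (@Lop R Omega mu n).
Implicit Types (i j : 'I_n) (S T : {set 'I_n}) (f g h : pt -> R) (x y z : pt).

Definition expect g : R := \sum_y mun mu y * g y.

(* All the operators of the statement are products over the coordinates of
   [u_i E_i + v_i L_i]; such products multiply componentwise in [(u, v)],
   because [E_i] and [L_i] are complementary projections. *)
Definition kop (a b : R) i g : pt -> R := fun y => a * E_ i g y + b * L_ i g y.

Definition popl (u v : 'I_n -> R) (l : seq 'I_n) g : pt -> R :=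
  foldr (fun i h => kop (u i) (v i) i h) g l.

Definition pop u v g := popl u v (enum 'I_n) g.

Lemma upd_upd y i a b : upd (upd y i a) i b = upd y i b.
Proof. by apply/ffunP => j; rewrite !ffunE; case: eqP. Qed.

Lemma updC y i j a b : i != j -> upd (upd y i a) j b = upd (upd y j b) i a.
Proof.
move=> ij; apply/ffunP => k; rewrite !ffunE.
by case: (k =P j) => // ->; rewrite eq_sym (negbTE ij).
Qed.

Lemma upd_id y i : upd y i (y i) = y.
Proof. by apply/ffunP => j; rewrite !ffunE; case: eqP => // ->. Qed.

Lemma Eop_upd i g y a : E_ i g (upd y i a) = E_ i g y.
Proof. by apply: eq_bigr => b _; rewrite upd_upd. Qed.

Lemma Eop_lin i c d g h :
  E_ i (fun y => c * g y + d * h y) = fun y => c * E_ i g y + d * E_ i h y.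
Proof.
apply/funext => y; rewrite /Eop !mulr_sumr -big_split /=.
by apply: eq_bigr => a _; ring.
Qed.

Lemma EopK i g : E_ i (E_ i g) = E_ i g.
Proof.
apply/funext => y; rewrite {1}/Eop; under eq_bigr do rewrite Eop_upd.
by rewrite -mulr_suml mu_sum1 mul1r.
Qed.

Lemma EopC i j g : E_ i (E_ j g) = E_ j (E_ i g).
Proof.
have [->//|ij] := eqVneq i j; apply/funext => y; rewrite /Eop.
under eq_bigr do rewrite mulr_sumr.
rewrite exchange_big /=; apply: eq_bigr => a _; rewrite mulr_sumr.
by apply: eq_bigr => b _; rewrite mulrCA updC.
Qed.

Lemma kopE a b i g : kop a b i g = fun y => (a - b) * E_ i g y + b * g y.
Proof. by apply/funext => y; rewrite /kop /Lop; ring. Qed.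

Lemma EopE i g : E_ i g = kop 1 0 i g.
Proof. by apply/funext => y; rewrite kopE; ring. Qed.

Lemma LopE i g : L_ i g = kop 0 1 i g.
Proof. by apply/funext => y; rewrite kopE /Lop; ring. Qed.

Lemma kop11 i g : kop 1 1 i g = g.
Proof. by apply/funext => y; rewrite kopE; ring. Qed.

Lemma kopC a b c d i j g : kop a b i (kop c d j g) = kop c d j (kop a b i g).
Proof.
by apply/funext => y; rewrite !kopE !Eop_lin EopC; ring.
Qed.

Lemma kop_kop a b c d i g : kop a b i (kop c d i g) = kop (a * c) (b * d) i g.
Proof. by apply/funext => y; rewrite !kopE !Eop_lin EopK; ring. Qed.

Lemma kop_popl a b i u v l g : kop a b i (popl u v l g) = popl u v l (kop a b i g).
Proof. by elim: l => //= j l IH; rewrite kopC IH. Qed.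

Lemma popl_popl u v u' v' l g :
  popl u v l (popl u' v' l g) = popl (fun i => u i * u' i) (fun i => v i * v' i) l g.
Proof. by elim: l => //= i l IH; rewrite -kop_popl kop_kop IH. Qed.

Lemma pop_pop u v u' v' g :
  pop u v (pop u' v' g) = pop (fun i => u i * u' i) (fun i => v i * v' i) g.
Proof. exact: popl_popl. Qed.

Lemma eq_pop u v u' v' : u =1 u' -> v =1 v' -> pop u v = pop u' v'.
Proof. by move=> /funext-> /funext->. Qed.

(** Coordinates outside [S] are padded with [kop 1 1], the identity, so that operators indexed by
    different sets run over the same list and compose by [pop_pop]. *)
Lemma foldr_enum (F : 'I_n -> (pt -> R) -> pt -> R) u v S g :
  (forall i h, i \in S -> F i h = kop (u i) (v i) i h) ->
  (forall i, i \notin S -> u i = 1 /\ v i = 1) ->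
  foldr F g (enum S) = pop u v g.
Proof.
move=> hF huv; rewrite /pop {1}/enum_mem -enumT.
elim: (enum 'I_n) => //= i l IH; case: ifP => [iS|/negbT/huv[-> ->]].
  by rewrite /= hF// IH.
by rewrite kop11.
Qed.

Lemma LSE S g : LS mu S g = pop (fun i => (i \notin S)%:R) (fun=> 1) g.
Proof.
by apply: foldr_enum => [i h iS|i ->]//; rewrite iS LopE.
Qed.

Lemma ESE S g : ES mu S g = pop (fun=> 1) (fun i => (i \notin S)%:R) g.
Proof.
by apply: foldr_enum => [i h iS|i ->]//; rewrite iS EopE.
Qed.

Lemma fpartE T g :
  fpart mu T g = pop (fun i => (i \notin T)%:R) (fun i => (i \in T)%:R) g.
Proof.
rewrite /fpart LSE ESE pop_pop; apply: (congr1 (fun F => F g)).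
by apply: eq_pop => i; rewrite ?inE ?negbK ?mul1r ?mulr1.
Qed.

Lemma kopZ a b c i g : kop (c * a) (c * b) i g = fun y => c * kop a b i g y.
Proof. by apply/funext => y; rewrite /kop; ring. Qed.

Lemma kop_scal a b i c g : kop a b i (fun y => c * g y) = fun y => c * kop a b i g y.
Proof.
apply/funext => y; rewrite !kopE.
have -> : (fun y => c * g y) = (fun y => c * g y + 0 * g y).
  by apply/funext => z; ring.
by rewrite Eop_lin; ring.
Qed.

Lemma kop_sum (I : Type) (r : seq I) (P : pred I) a b i (F : I -> pt -> R) :
  kop a b i (fun y => \sum_(k <- r | P k) F k y) =
  fun y => \sum_(k <- r | P k) kop a b i (F k) y.
Proof.
apply/funext => y; rewrite kopE.
under [RHS]eq_bigr do rewrite kopE.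
rewrite big_split /= -!mulr_sumr; congr (_ * _ + _).
by rewrite /Eop exchange_big /=; apply: eq_bigr => c _; rewrite mulr_sumr.
Qed.

(** Used with [prod_indicator]: a set condition failing at a single coordinate makes the whole
    product vanish, which is how orthogonality of the parts is obtained. *)
Lemma popZ (c : 'I_n -> R) u v g :
  pop (fun i => c i * u i) (fun i => c i * v i) g =
  fun y => (\prod_i c i) * pop u v g y.
Proof.
rewrite -big_enum /pop /=; elim: (enum _) => [|i l IH] /=.
  by apply/funext => y; rewrite big_nil mul1r.
rewrite IH kopZ kop_scal big_cons; apply/funext => y; ring.
Qed.

Lemma pop_sum (I : Type) (r : seq I) (P : pred I) u v (F : I -> pt -> R) :
  pop u v (fun y => \sum_(k <- r | P k) F k y) =
  fun y => \sum_(k <- r | P k) pop u v (F k) y.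
Proof.
by rewrite /pop; elim: (enum _) => //= i l ->; rewrite kop_sum.
Qed.

Lemma prod_indicator (b : pred 'I_n) : \prod_i (b i)%:R = [forall i, b i]%:R :> R.
Proof.
case: forallP => [hb|/forallP]; first by rewrite big1// => i _; rewrite hb.
rewrite negb_forall => /existsP[i hi].
by rewrite (bigD1 i)//= (negbTE hi) mul0r.
Qed.

Lemma fpart_fpart T T' f :
  fpart mu T (fpart mu T' f) = fun y => (T == T')%:R * fpart mu T f y.
Proof.
have -> : (T == T') = [forall i, (i \in T) == (i \in T')].
  by apply/eqP/forallP => [-> //|e]; apply/setP => i; apply/eqP.
rewrite !fpartE -prod_indicator -popZ pop_pop.
apply: (congr1 (fun F => F f)).
by apply: eq_pop => i; case: (i \in T); case: (i \in T'); rewrite /= ?mul0r ?mulr0 ?mulr1.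
Qed.

Lemma LS_fpart S T f :
  LS mu S (fpart mu T f) = fun y => (S \subset T)%:R * fpart mu T f y.
Proof.
have -> : (S \subset T) = [forall i, (i \in S) ==> (i \in T)].
  by apply/subsetP/forallP => h i; [apply/implyP/h|move/implyP: (h i)].
rewrite LSE !fpartE -prod_indicator -popZ pop_pop.
apply: (congr1 (fun F => F f)).
by apply: eq_pop => i; case: (i \in S); case: (i \in T); rewrite /= ?mul0r ?mulr0 ?mulr1 ?mul1r.
Qed.

Lemma fpart_fdeg T d f : #|T| = d -> fpart mu T (fdeg mu d f) = fpart mu T f.
Proof.
move=> cT; rewrite fpartE pop_sum; apply/funext => y.
rewrite (bigD1 T) ?cT ?eqxx//= big1 => [|T' /andP[_ T'T]].
  by rewrite -!fpartE fpart_fpart eqxx mul1r addr0.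
by rewrite -fpartE fpart_fpart eq_sym (negbTE T'T) mul0r.
Qed.

(** On [fpart mu T f] the operator acts by [c] at each coordinate of [T] and trivially elsewhere, so
    all sets of size [d] share one eigenvalue. *)
Lemma noise_fdeg c d f : pop (fun=> 1) (fun=> c) (fdeg mu d f) =
  fun y => c ^+ d * fdeg mu d f y.
Proof.
rewrite pop_sum; apply/funext => y; rewrite /fdeg mulr_sumr.
apply: eq_bigr => T /eqP cT.
have -> : c ^+ d = \prod_i (if i \in T then c else 1).
  by rewrite -big_mkcond /= prodr_const cT.
rewrite fpartE -[RHS](congr1 (fun F => F y) (popZ _ _ _ _)) pop_pop.
apply: (congr1 (fun F => F f y)).
by apply: eq_pop => i; case: (i \in T); rewrite /= ?mul0r ?mulr0 ?mulr1 ?mul1r.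
Qed.

Lemma LS_idem S g : LS mu S (LS mu S g) = LS mu S g.
Proof.
rewrite !LSE pop_pop; apply: (congr1 (fun F => F g)).
by apply: eq_pop => i; case: (i \in S); rewrite /= ?mul0r ?mulr1.
Qed.

Lemma LS_setU S S' g : LS mu S (LS mu S' g) = LS mu (S :|: S') g.
Proof.
rewrite !LSE pop_pop; apply: (congr1 (fun F => F g)).
by apply: eq_pop => i; rewrite ?inE; case: (i \in S); case: (i \in S');
  rewrite /= ?mul0r ?mulr1 ?mulr0.
Qed.

Lemma LS1 i g : LS mu [set i] g = L_ i g.
Proof. by rewrite /LS enum_set1. Qed.

Lemma LS0 g : LS mu set0 g = g.
Proof. by rewrite /LS enum_set0. Qed.

(** * Expectation under the product measure, and self-adjointness *)

Lemma mun_ge0 y : 0 <= mun mu y.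
Proof. exact: prodr_ge0. Qed.

Lemma mun_sum1 : \sum_(y : pt) mun mu y = 1.
Proof.
rewrite /mun -(bigA_distr_bigA (fun=> mu)) /=.
by rewrite big1// => i _.
Qed.

Lemma eq_expect g h : g =1 h -> expect g = expect h.
Proof. by move=> /funext->. Qed.

Lemma expect_const c : expect (fun=> c) = c.
Proof. by rewrite /expect -mulr_suml mun_sum1 mul1r. Qed.

Lemma expect_ge0 g : (forall y, 0 <= g y) -> 0 <= expect g.
Proof. by move=> g0; apply: sumr_ge0 => y _; rewrite mulr_ge0 ?mun_ge0. Qed.

Lemma le_expect g h : (forall y, g y <= h y) -> expect g <= expect h.
Proof. by move=> gh; apply: ler_sum => y _; rewrite ler_wpM2l ?mun_ge0. Qed.

Lemma expect_lin c d g h :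
  expect (fun y => c * g y + d * h y) = c * expect g + d * expect h.
Proof.
rewrite /expect !mulr_sumr -big_split /=; apply: eq_bigr => y _; ring.
Qed.

Lemma expectZ c g : expect (fun y => c * g y) = c * expect g.
Proof. by rewrite /expect mulr_sumr; apply: eq_bigr => y _; ring. Qed.

Lemma mun_upd y i a : mun mu y * mu a = mun mu (upd y i a) * mu (y i).
Proof.
rewrite /mun (bigD1 i)//= [in RHS](bigD1 i)//= ffunE eqxx.
rewrite mulrC [RHS]mulrAC -[RHS]mulrA; congr (_ * (_ * _)).
by apply: eq_bigr => j /negbTE ji; rewrite ffunE ji.
Qed.

Lemma expect_Eop i g : expect (E_ i g) = expect g.
Proof.
rewrite /expect /Eop; under eq_bigr do rewrite mulr_sumr.
rewrite pair_big /=.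
(* Swapping [y i] with the fresh sample preserves the joint weight, by [mun_upd]. *)
pose phi (p : pt * Omega) := (upd p.1 i p.2, p.1 i).
have phiK : involutive phi.
  by move=> [y a]; rewrite /phi /= upd_upd upd_id ffunE eqxx.
rewrite (reindex_inj (inv_inj phiK)) /=.
under eq_bigr do rewrite mulrA upd_upd upd_id -mun_upd -mulrA [mu _ * _]mulrC.
rewrite -(pair_big xpredT xpredT (fun y a => mun mu y * (g y * mu a))) /=.
by apply: eq_bigr => y _; rewrite -!mulr_sumr mu_sum1 mulr1.
Qed.

Lemma Eop_mulr i g h : E_ i (fun y => g y * E_ i h y) = fun y => E_ i g y * E_ i h y.
Proof.
apply/funext => y; rewrite {1}/Eop; under eq_bigr do rewrite Eop_upd mulrA.
by rewrite -mulr_suml.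
Qed.

(** Both sides equal the expectation of [E_ i g y * E_ i h y]: a function averaged over coordinate
    [i] factors out of a further averaging. *)
Lemma Eop_sym i g h :
  expect (fun y => E_ i g y * h y) = expect (fun y => g y * E_ i h y).
Proof.
rewrite -(expect_Eop i) -[RHS](expect_Eop i) Eop_mulr.
rewrite (_ : (fun y => _) = (fun y => h y * E_ i g y)) ?Eop_mulr; last first.
  by apply/funext => y; rewrite mulrC.
by apply: eq_expect => y; rewrite mulrC.
Qed.

Lemma kop_sym a b i g h :
  expect (fun y => kop a b i g y * h y) = expect (fun y => g y * kop a b i h y).
Proof.
rewrite !kopE.
transitivity (expect (fun y => (a - b) * (E_ i g y * h y) + b * (g y * h y))).
  by apply: eq_expect => y; ring.
by rewrite expect_lin Eop_sym -expect_lin; apply: eq_expect => y; ring.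
Qed.

Lemma popl_sym u v l g h :
  expect (fun y => popl u v l g y * h y) = expect (fun y => g y * popl u v l h y).
Proof.
elim: l g h => //= i l IH g h.
by rewrite kop_sym IH kop_popl.
Qed.

Lemma pop_sym u v g h :
  expect (fun y => pop u v g y * h y) = expect (fun y => g y * pop u v h y).
Proof. exact: popl_sym. Qed.

Lemma expect_LS S g : expect (fun y => LS mu S g y * g y) = expect (fun y => LS mu S g y ^+ 2).
Proof. 
transitivity (expect (fun y => LS mu S (LS mu S g) y * g y)).
  by rewrite LS_idem.
rewrite {1}(LSE S (LS mu S g)) pop_sym.
by apply: eq_expect => y; rewrite expr2 [in RHS]LSE [in LHS]LSE. Qed.

(** Each [fpart mu T] is self-adjoint and, when [#|T| = d], sends [f] and [fdeg mu d f] to the same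
    function. *)
Lemma expect_fdeg d f :
  expect (fun y => fdeg mu d f y ^+ 2) = expect (fun y => f y * fdeg mu d f y).
Proof.
have fdegE g h : expect (fun y => g y * fdeg mu d h y) =
    \sum_(T : {set 'I_n} | #|T| == d) expect (fun y => g y * fpart mu T h y).
  rewrite /expect; under eq_bigr do rewrite /fdeg !mulr_sumr.
  by rewrite exchange_big.
rewrite (eq_expect (fun y => expr2 _)) !fdegE; apply: eq_bigr => T /eqP cT.
rewrite -{2}(fpart_fdeg f cT) [in RHS]fpartE -pop_sym -fpartE.
by apply: eq_expect => y; rewrite mulrC.
Qed.

End Operators.

(** * Hypercontractivity for global functions *)

Section Hypercontractivity.
Variables (R : realType) (Omega : finType) (mu : Omega -> R) (n : nat).
Hypothesis mu_ge0 : forall a, 0 <= mu a.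
Hypothesis mu_sum1 : \sum_(a : Omega) mu a = 1.

Notation pt := {ffun 'I_n -> Omega}.
Notation E_ := (@Eop R Omega mu n).
Notation L_ := (@Lop R Omega mu n).
Notation merge := Defs.merge.
Implicit Types (i j : 'I_n) (S T M : {set 'I_n}) (f g h V : pt -> R) (x y z : pt).
Notation Ex := (@expect R Omega mu n).

Lemma merge_upd_in M x y i a : i \in M -> merge M (upd x i a) y = upd (merge M x y) i a.
Proof.
by move=> iM; apply/ffunP => j; rewrite !ffunE; case: eqP => // ->; rewrite iM.
Qed.

Lemma merge_upd_in_id M x y i a : i \in M -> merge M x (upd y i a) = merge M x y.
Proof.
by move=> iM; apply/ffunP => j; rewrite !ffunE; case: (j =P i) => // ->; rewrite iM.
Qed.

Lemma merge_upd_out M x y i a :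
  i \notin M -> merge M x (upd y i a) = upd (merge M x y) i a.
Proof.
by move=> /negbTE iM; apply/ffunP => j; rewrite !ffunE; case: eqP => // ->; rewrite iM.
Qed.

Lemma merge_upd_D1 M x y i a : upd (merge (M :\ i) x y) i a = upd (merge M x y) i a.
Proof. by apply/ffunP => j; rewrite !ffunE !inE; case: eqP. Qed.

Lemma merge0 x y : merge set0 x y = y.
Proof. by apply/ffunP => j; rewrite ffunE inE. Qed.

Lemma mergeT x y : merge setT x y = x.
Proof. by apply/ffunP => j; rewrite ffunE inE. Qed.

Lemma expect_EopD1 M x i g : i \in M ->
  Ex (fun y => g (merge (M :\ i) x y)) =
  \sum_a mu a * Ex (fun y => g (upd (merge M x y) i a)).
Proof.
move=> iM; rewrite -(expect_Eop _ i)// /expect.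
under [RHS]eq_bigr do rewrite mulr_sumr.
rewrite exchange_big /=; apply: eq_bigr => y _.
rewrite /Eop mulr_sumr; apply: eq_bigr => a _.
by rewrite mulrCA merge_upd_out ?merge_upd_D1// !inE eqxx.
Qed.

Lemma expect_merge M g : Ex (fun x => Ex (fun y => g (merge M x y))) = Ex g.
Proof.
move: {2}#|M| (erefl #|M|) => m; elim: m M => [|m IH] M.
  move/eqP; rewrite cards_eq0 => /eqP->.
  rewrite -[RHS](expect_const n mu_sum1); apply: eq_expect => x.
  by apply: eq_expect => y; rewrite merge0.
move=> cM; have [i iM] : exists i, i \in M by apply/card_gt0P; rewrite cM.
rewrite -(IH (M :\ i)); last by move: cM; rewrite (cardsD1 i) iM => -[].
rewrite -(expect_Eop _ i)//; apply: eq_expect => x.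
rewrite expect_EopD1//; apply: eq_bigr => a _; congr (_ * _).
by apply: eq_expect => y; rewrite merge_upd_in.
Qed.

(** The [2m]-th power, [m = k.+2], of the L_2m norm in the coordinates of [M] with values in L_2 of
    the others. It interpolates between the L_2 norm at [set0] and the L_2m norm at [setT]. *)
Definition mixed_norm (k : nat) M V : R :=
  Ex (fun x => Ex (fun y => V (merge M x y) ^+ 2) ^+ k.+2).

(** For fixed [x] this is [hilbert_one_coordinate] in L_2 of the points [y], with [a] from [E_ i V]
    and [h] from [L_ i V]. Coordinate [i] either passes to the L_2 side or stays and is
    differentiated. *)
Lemma mixed_norm_step k rho M i V : i \in M -> 16 * k.+2%:R * rho ^+ 2 <= 1 ->
  mixed_norm k M (kop mu 1 rho i V) <=
  mixed_norm k (M :\ i) V + (2 * k.+2%:R) ^+ k.+2 * mixed_norm k M (L_ i V).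
Proof.
move=> iM hrho; rewrite /mixed_norm -(expect_Eop _ i)//.
rewrite -[in X in _ + _ * X](expect_Eop _ i)//.
rewrite -[X in X + _]mul1r -expect_lin; apply: le_expect => // x.
rewrite mul1r.
pose a y := E_ i V (merge M x y).
pose h b y := L_ i V (upd (merge M x y) i b).
have h0 y : \sum_b mu b * h b y = 0.
  rewrite /h /Lop; under eq_bigr do rewrite Eop_upd mulrBr.
  by rewrite sumrB -mulr_suml mu_sum1 mul1r subrr.
have hil := hilbert_one_coordinate a mu_ge0 mu_sum1 (mun_ge0 mu_ge0) hrho h0.
(* Pythagoras in coordinate [i]: the cross term carries the factor [\sum_b mu b * h b y], which is
   zero. *)
have -> : Ex (fun y => V (merge (M :\ i) x y) ^+ 2) =
    (\sum_y mun mu y * a y ^+ 2) + \sum_b mu b * (\sum_y mun mu y * h b y ^+ 2).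
  rewrite (expect_EopD1 x (fun z => V z ^+ 2) iM) /expect.
  under [in LHS]eq_bigr do rewrite mulr_sumr.
  under [X in _ = _ + X]eq_bigr do rewrite mulr_sumr.
  rewrite exchange_big [in RHS]exchange_big -big_split /=; apply: eq_bigr => y _.
  transitivity (mun mu y * ((\sum_b mu b) * a y ^+ 2 + 2 * a y * (\sum_b mu b * h b y)
    + \sum_b mu b * h b y ^+ 2)).
    rewrite mulr_suml [2 * a y * _]mulr_sumr -!big_split mulr_sumr /=; apply: eq_bigr => b _.
    rewrite /h /Lop Eop_upd -/(a y). ring.
  rewrite h0 mu_sum1 mulr0 addr0 mul1r mulrDr; congr (_ + _).
  by rewrite mulr_sumr; apply: eq_bigr => b _; ring.
move: hil; congr (is_true (_ <= _ + _ * _)); apply: eq_bigr => b _; congr (_ * _ ^+ _).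
  apply: eq_expect => y; rewrite merge_upd_in// /kop Eop_upd mul1r.
  by [].
by apply: eq_expect => y; rewrite merge_upd_in.
Qed.

(** Of the [k.+2] factors of the squared norm, globalness bounds [k.+1]; the one kept averages over
    [x] to the squared norm of [LS mu S g]. Here [r2] and [X] play the squares of the radius and of
    [gamma]. *)
Lemma mixed_norm_LS k r2 X g S : 0 <= r2 -> 0 <= X ->
  (forall S x, Ex (fun y => Dop mu S x g y ^+ 2) <= r2 ^+ #|S| * X) ->
  mixed_norm k S (LS mu S g) <=
  (r2 ^+ #|S| * X) ^+ k.+1 * Ex (fun y => LS mu S g y * g y).
Proof.
move=> r0 X0 hD; rewrite expect_LS// -(expect_merge S (fun z => LS mu S g z ^+ 2)) -expectZ.
apply: le_expect => // x; rewrite exprSr.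
have D0 : 0 <= Ex (fun y => LS mu S g (merge S x y) ^+ 2).
  by apply: expect_ge0 => // y; rewrite sqr_ge0.
rewrite ler_wpM2r// lerXn2r ?nnegrE//; last exact: hD.
by rewrite mulr_ge0// exprn_ge0.
Qed.

(** Induction over the untreated coordinates [l]; [S] collects those where the derivative branch of
    [mixed_norm_step] was taken. The two branches at [i] contribute the identity and [b * L_ i],
    which add up to [kop mu 1 (1 + b) i]. *)
Lemma mixed_norm_noise k rho r2 X g : 16 * k.+2%:R * rho ^+ 2 <= 1 ->
  0 <= r2 -> 0 <= X ->
  (forall S x, Ex (fun y => Dop mu S x g y ^+ 2) <= r2 ^+ #|S| * X) ->
  let c := (2 * k.+2%:R) ^+ k.+2 in
  let b := c * r2 ^+ k.+1 in
  forall l S, uniq l -> {in l, forall i, i \notin S} ->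
  c ^+ #|S| * mixed_norm k (S :|: [set i in l])
                (popl mu (fun=> 1) (fun=> rho) l (LS mu S g)) <=
  X ^+ k.+1 * b ^+ #|S| *
    Ex (fun y => popl mu (fun=> 1) (fun=> 1 + b) l (LS mu S g) y * g y).
Proof.
move=> hrho r0 X0 hD c b.
have c0 : 0 <= c by rewrite exprn_ge0// mulr_ge0.
elim=> [|i l IH] S /=.
  move=> _ _; rewrite (_ : [set i in [::]] = set0) ?setU0; last first.
    by apply/setP => i; rewrite !inE.
  apply: le_trans (ler_wpM2l (exprn_ge0 _ c0) (mixed_norm_LS k S r0 X0 hD)) _.
  rewrite le_eqVlt; apply/orP; left; apply/eqP.
  by rewrite mulrA /b !exprMn -!exprM (mulnC #|S|); ring.
move=> /andP[il ul] hS.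
have iS : i \notin S by apply: hS; rewrite mem_head.
have hl : {in l, forall j, j \notin S}.
  by move=> j jl; apply: hS; rewrite inE jl orbT.
have hl' : {in l, forall j, j \notin i |: S}.
  move=> j jl; rewrite !inE negb_or hl// andbT.
  by apply: contraNneq il => <-.
set M := _ :|: _.
have iM : i \in M by rewrite !inE eqxx orbT.
have MD : M :\ i = S :|: [set j in l].
  apply/setP => j; rewrite !inE; case: eqP => [->|] //=.
  by rewrite (negbTE iS) (negbTE il).
have MU : M = (i |: S) :|: [set j in l].
  by apply/setP => j; rewrite !inE; case: eqP => //=; rewrite orbT.
have cS : #|i |: S| = #|S|.+1 by rewrite cardsU1 iS.
have LiS : L_ i (LS mu S g) = LS mu (i |: S) g.
  by rewrite -LS1 LS_setU.
have Lpop u v : L_ i (popl mu u v l (LS mu S g)) = popl mu u v l (LS mu (i |: S) g).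
  by rewrite LopE kop_popl// -LopE LiS.
apply: le_trans (ler_wpM2l (exprn_ge0 _ c0) (mixed_norm_step _ iM hrho)) _.
rewrite MD Lpop MU mulrDr mulrA -exprSr.
have h1 := IH _ ul hl; have := IH _ ul hl'; rewrite cS => h2.
apply: le_trans (lerD h1 h2) _.
rewrite (exprSr b) (mulrA (X ^+ _)) -(mulrA _ b) -mulrDr -[Y in Y + _]mul1r -expect_lin.
rewrite le_eqVlt; apply/orP; left; apply/eqP; congr (_ * _).
apply: eq_expect => y; rewrite -Lpop /kop /Lop; ring.
Qed.

Lemma hypercontractive k rho r2 X g : 16 * k.+2%:R * rho ^+ 2 <= 1 ->
  0 <= r2 -> 0 <= X ->
  (forall S x, Ex (fun y => Dop mu S x g y ^+ 2) <= r2 ^+ #|S| * X) ->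
  Ex (fun y => pop mu (fun=> 1) (fun=> rho) g y ^+ k.+2.*2) <=
  X ^+ k.+1 * Ex (fun y =>
    pop mu (fun=> 1) (fun=> 1 + (2 * k.+2%:R) ^+ k.+2 * r2 ^+ k.+1) g y * g y).
Proof.
move=> hrho r0 X0 hD.
have := mixed_norm_noise hrho r0 X0 hD (enum_uniq 'I_n) (S := set0).
rewrite cards0 !expr0 mul1r mulr1 LS0 => hmain.
have {}hmain := hmain (fun i _ => negbT (in_set0 i)).
apply: le_trans hmain.
rewrite le_eqVlt; apply/orP; left; apply/eqP; apply: eq_expect => x.
have -> : set0 :|: [set i in enum 'I_n] = setT.
  by apply/setP => i; rewrite !inE mem_enum.
under eq_expect do rewrite mergeT.
by rewrite expect_const// -exprM mul2n.
Qed.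

End Hypercontractivity.

(** * Derivatives of the degree-d part *)

Section Derivatives.
Variables (R : realType) (Omega : finType) (mu : Omega -> R) (n : nat).
Hypothesis mu_ge0 : forall a, 0 <= mu a.
Hypothesis mu_sum1 : \sum_(a : Omega) mu a = 1.

Notation pt := {ffun 'I_n -> Omega}.
Notation merge := Defs.merge.
Notation Ex := (@expect R Omega mu n).
Implicit Types (i j : 'I_n) (S T M : {set 'I_n}) (f g h V : pt -> R) (x y z : pt).

Lemma kop_merge_out a b S x i g : i \notin S ->
  kop mu a b i (fun y => g (merge S x y)) = fun y => kop mu a b i g (merge S x y).
Proof.
move=> iS; apply/funext => y; rewrite !kopE; congr (_ * _ + _).
by apply: eq_bigr => c _; rewrite merge_upd_out.
Qed.

Lemma kop_merge_in a b S x i g : i \in S ->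
  kop mu a b i (fun y => g (merge S x y)) = fun y => a * g (merge S x y).
Proof.
move=> iS; apply/funext => y; rewrite kopE /Eop.
under eq_bigr do rewrite merge_upd_in_id//.
by rewrite -mulr_suml mu_sum1; ring.
Qed.

(** After restriction the function is constant in each coordinate of [S], where [E_i] is the
    identity and [L_i] is zero; only the scalar [u i] survives there. *)
Lemma pop_merge u v S x g :
  pop mu u v (fun y => g (merge S x y)) =
  fun y => (\prod_i (if i \in S then u i else 1)) *
    pop mu (fun i => if i \in S then 1 else u i)
           (fun i => if i \in S then 1 else v i) g (merge S x y).
Proof.
rewrite -big_enum /pop /=; elim: (enum _) => [|i l IH] /=.
  by apply/funext => y; rewrite big_nil mul1r.
rewrite IH kop_scal// big_cons; apply/funext => y; case: ifPn => iS.
  by rewrite kop_merge_in// kop11; ring.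
by rewrite kop_merge_out//; ring.
Qed.

Lemma disjoint_indicator S T :
  [forall i, ~~ ((i \in S) && (i \in T))] = [disjoint S & T].
Proof.
by apply/forallP/pred0P => h i /=; [apply/negbTE/h|apply/negbT/h].
Qed.

Lemma fpart_Dop S T x f y : fpart mu T (Dop mu S x f) y =
  [disjoint S & T]%:R * fpart mu (T :|: S) f (merge S x y).
Proof.
rewrite fpartE// /Dop pop_merge -disjoint_indicator -prod_indicator; congr (_ * _).
  by apply: eq_bigr => i _; case: (i \in S).
rewrite LSE// pop_pop// fpartE//; apply: (congr1 (fun F => F f (merge S x y))).
by apply: eq_pop => i; rewrite !inE; case: (i \in S); case: (i \in T);
  rewrite /= ?mulr1 ?mulr0.
Qed.

Lemma Dop_Dop S S' x x' f y : Dop mu S' x' (Dop mu S x f) y =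
  [disjoint S & S']%:R * Dop mu (S' :|: S) (merge S x x') f y.
Proof.
rewrite {1}/Dop LSE// pop_merge -disjoint_indicator -prod_indicator; congr (_ * _).
  by apply: eq_bigr => i _; case: (i \in S).
rewrite LSE// pop_pop// /Dop LSE//.
have -> : merge S x (merge S' x' y) = merge (S' :|: S) (merge S x x') y.
  by apply/ffunP => i; rewrite !ffunE !inE; case: (i \in S); case: (i \in S').
apply: (congr1 (fun F => F f _)).
by apply: eq_pop => i; rewrite ?inE; case: (i \in S); case: (i \in S');
  rewrite /= ?mulr1 ?mulr0.
Qed.

Lemma Dop_fdeg S x d f y : Dop mu S x (fdeg mu d f) y =
  \sum_(T : {set 'I_n} | (#|T| == d) && (S \subset T)) fpart mu T f (merge S x y).
Proof.
rewrite /Dop LSE// pop_sum// big_mkcondr /=; apply: eq_bigr => T _.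
by rewrite -LSE// LS_fpart//; case: ifP; rewrite ?mul1r ?mul0r.
Qed.

Lemma Dop_fdeg_gt S x d f y : (d < #|S|)%N -> Dop mu S x (fdeg mu d f) y = 0.
Proof.
move=> dS; rewrite Dop_fdeg big1// => T /andP[/eqP cT /subset_leq_card].
by rewrite cT leqNgt dS.
Qed.

Lemma Dop_fdeg_le S x d f y : (#|S| <= d)%N ->
  Dop mu S x (fdeg mu d f) y = fdeg mu (d - #|S|) (Dop mu S x f) y.
Proof.
move=> Sd; rewrite Dop_fdeg /fdeg.
under [RHS]eq_bigr do rewrite fpart_Dop.
rewrite [RHS](eq_bigr (fun T =>
  if [disjoint S & T] then fpart mu (T :|: S) f (merge S x y) else 0)); last first.
  by move=> T _; case: ifP; rewrite ?mul1r ?mul0r.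
rewrite -big_mkcondr /=.
(* Sets of size [d] containing [S] correspond to sets of size [d - #|S|] disjoint from [S], by
   removing and adding [S]. *)
rewrite (reindex_onto (fun T => T :|: S) (fun T => T :\: S)) /=; last first.
  move=> T /andP[_ /subsetP ST]; apply/setP => i; rewrite !inE.
  by case: (boolP (i \in S)) => [/ST ->|]; rewrite ?orbF ?orbT.
apply: eq_bigl => T; rewrite subsetUr andbT.
have -> : ((T :|: S) :\: S == T) = [disjoint S & T].
  rewrite setDUl setDv setU0 disjoint_sym.
  by apply/eqP/setDidPl.
case: (boolP [disjoint S & T]) => [dST|]; rewrite ?andbF// !andbT.
have -> : #|T :|: S| = (#|T| + #|S|)%N.
  by rewrite cardsU disjoint_setI0 1?disjoint_sym// cards0 subn0.
by rewrite -[RHS](eqn_add2r #|S|) subnK.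
Qed.

Lemma Dop0 x g : Dop mu set0 x g = g.
Proof. by apply/funext => y; rewrite /Dop LS0 merge0. Qed.

Lemma norm1E g : norm1 mu g = Ex (fun y => `|g y|).
Proof. by []. Qed.

(** A derivative of a derivative is one along the union, or zero if the sets meet, so the bound for
    [f] splits off the factor [r ^+ #|S|]. *)
Lemma global1d_Dop r gamma d S x f : 0 <= r -> 0 <= gamma -> (#|S| <= d)%N ->
  global1d mu r gamma d f ->
  global1d mu r (r ^+ #|S| * gamma) (d - #|S|) (Dop mu S x f).
Proof.
move=> r0 g0 Sd hf S' x' hS'; rewrite norm1E.
have [dj|ndj] := boolP [disjoint S & S']; last first.
  rewrite (@eq_expect _ _ _ _ _ (fun=> 0)) ?expect_const ?mulr_ge0 ?exprn_ge0// => y.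
  by rewrite Dop_Dop (negbTE ndj) mul0r normr0.
have cU : #|S' :|: S| = (#|S'| + #|S|)%N.
  by rewrite cardsU disjoint_setI0 1?disjoint_sym// cards0 subn0.
have hU : (#|S' :|: S| <= d)%N by rewrite cU; lia.
have := hf _ (merge S x x') hU; rewrite cU exprD -mulrA; apply: le_trans.
rewrite norm1E le_eqVlt; apply/orP; left; apply/eqP.
by apply: eq_expect => y; rewrite Dop_Dop dj mul1r.
Qed.

Lemma norm2_le g c : 0 <= c -> (norm2 mu g <= c) = (Ex (fun y => g y ^+ 2) <= c ^+ 2).
Proof.
move=> c0; rewrite /norm2 -/(Ex (fun y => g y ^+ 2)).
have g0 : 0 <= Ex (fun y => g y ^+ 2) by apply: expect_ge0 => // y; rewrite sqr_ge0.
by rewrite -[in RHS](sqr_sqrtr g0) ler_pXn2r ?nnegrE ?sqrtr_ge0.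
Qed.

Lemma global2d_Dop r gamma d S x f : 0 <= r -> 0 <= gamma -> (#|S| <= d)%N ->
  global2d mu r gamma d f ->
  global2d mu r (r ^+ #|S| * gamma) (d - #|S|) (Dop mu S x f).
Proof.
move=> r0 g0 Sd hf S' x' hS'.
have [dj|ndj] := boolP [disjoint S & S']; last first.
  have c0 : 0 <= r ^+ #|S'| * (r ^+ #|S| * gamma) by rewrite !mulr_ge0 ?exprn_ge0.
  rewrite norm2_le// (@eq_expect _ _ _ _ _ (fun=> 0)) ?expect_const ?sqr_ge0// => y.
  by rewrite Dop_Dop (negbTE ndj) mul0r expr0n.
have cU : #|S' :|: S| = (#|S'| + #|S|)%N.
  by rewrite cardsU disjoint_setI0 1?disjoint_sym// cards0 subn0.
have hU : (#|S' :|: S| <= d)%N by rewrite cU; lia.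
have := hf _ (merge S x x') hU; rewrite cU exprD -mulrA.
rewrite (_ : Dop mu S' x' _ = Dop mu (S' :|: S) (merge S x x') f)//.
by apply/funext => y; rewrite Dop_Dop dj mul1r.
Qed.

End Derivatives.

(** * The level-d inequality *)

Section LevelInequality.
Variable R : realType.

Lemma expR1_le4 : expR 1 <= 4 :> R.
Proof.
(* The bound [1 + x <= expR x] at [x = - 1 / 2]. *)
have h : 1 / 2 <= (expR (1 / 2 : R))^-1.
  by rewrite -expRN; apply: le_trans (expR_ge1Dx _); lra.
have e0 : 0 < expR (1 / 2 : R) := expR_gt0 _.
have e2 : expR (1 / 2 : R) <= 2.
  by move: h; rewrite -(ler_pM2r e0) mulVf ?gt_eqF//; lra.
have -> : expR 1 = expR (1 / 2) * expR (1 / 2) :> R.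
  by rewrite -expRD; congr expR; lra.
nra.
Qed.

(** For positive [k], the [k]-th power of [1 + s / k] is at most [expR s], hence at most
    [4 ^+ s]. *)
Lemma pow_one_plus_le4 (k s : nat) : (k + s)%:R ^+ k <= 4 ^+ s * k%:R ^+ k :> R.
Proof.
case: k => [|k]; first by rewrite !expr0 mulr1 exprn_ege1//; lra.
set K : R := k.+1%:R; have K0 : 0 < K by rewrite ltr0n.
have -> : (k.+1 + s)%:R = K * (1 + s%:R / K) :> R.
  by rewrite natrD mulrDr mulr1 mulrCA mulfV ?mulr1// gt_eqF.
rewrite exprMn mulrC ler_wpM2r ?exprn_ge0 ?(ltW K0)//.
apply: le_trans (_ : expR (s%:R / K) ^+ k.+1 <= _).
  by rewrite lerXn2r ?nnegrE ?expR_ge0 ?expR_ge1Dx// addr_ge0// divr_ge0// ltW.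
rewrite -expRM_natr -/K mulfVK ?gt_eqF// -[s%:R]mul1r expRM_natr.
by rewrite lerXn2r ?nnegrE ?expR_ge0 ?expR1_le4.
Qed.

(** Compares level [k] for a derivative along [s] coordinates with level [k + s] for the function.
    The [s] extra factors [(33 * r) ^+ 2] absorb [r ^+ s] squared and leave 1 / 1089 each; changing
    the denominator from [k] to [k + s] costs [4 ^+ s]. *)
Lemma level_radius_gain (k s : nat) (r L : R) : 1 <= r -> 0 < L ->
  (r ^+ s) ^+ 2 * ((33 * r) ^+ 2 * (L / k%:R)) ^+ k <=
  (4 / 1089 * ((k + s)%:R / L)) ^+ s * ((33 * r) ^+ 2 * (L / (k + s)%:R)) ^+ (k + s).
Proof.
move=> r1 L0; have [->|s0] := posnP s.
  by rewrite addn0 !expr0 expr1n !mul1r.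
set d : R := (k + s)%:R; have d0 : 0 < d by rewrite ltr0n addn_gt0 s0 orbT.
have -> : (4 / 1089 * (d / L)) ^+ s * ((33 * r) ^+ 2 * (L / d)) ^+ (k + s) =
   (r ^+ s) ^+ 2 * (4 ^+ s * ((33 * r) ^+ 2 * (L / d)) ^+ k).
  rewrite exprD [X in _ * X]mulrC !mulrA -exprMn.
  rewrite -exprM mulnC exprM -exprMn; congr (_ ^+ _ * _).
  by field; rewrite -natrD -/d (gt_eqF d0) (gt_eqF L0).
rewrite ler_wpM2l ?sqr_ge0//.
have [->|k0] := posnP k.
  by rewrite !expr0 mulr1 exprn_ege1//; lra.
move: (sqr_ge0 (33 * r)); set Q := (33 * r) ^+ 2; move: Q => Q Q0.
rewrite !(exprMn _ Q) [leRHS]mulrCA ler_wpM2l ?exprn_ge0//.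
rewrite !(exprMn _ L) !exprVn [leRHS]mulrCA ler_wpM2l ?exprn_ge0 ?(ltW L0)//.
rewrite ler_pdivlMr ?exprn_gt0//.
rewrite mulrC ler_pdivrMr ?exprn_gt0 ?ltr0n//.
exact: pow_one_plus_le4.
Qed.

(** Here [X] is the squared L_2 norm of [g] and [P] its L_2m norm to the power [2m], with
    [m = k.+2]. Eliminating [P] and cancelling [X ^+ k.+2], one uses
    [expR L ^+ 2 <= 16 ^+ (d * k.+2)] and takes [m]-th roots; 512 is 16 * 2 * 16. *)
Lemma level_conclusion (k d : nat) (X g1 L lam P : R) :
  let M := k.+2%:R in
  0 < X -> 0 < g1 -> L = lam * d%:R -> lam <= M ->
  (1 / (16 * M)) ^+ (d * k.+2) * P <= X ^+ k.+2 * 2 ^+ d ->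
  X ^+ k.+2.*2 <= g1 ^+ k.+1.*2 * (g1 * expR L) ^+ 2 * P ->
  X <= g1 ^+ 2 * (512 * M) ^+ d.
Proof.
move=> M X0 g0 hL hlam h1 h2.
have M0 : 0 < M by rewrite ltr0n.
have W0 : 0 < (16 * M) ^+ (d * k.+2) by rewrite exprn_gt0// mulr_gt0.
have hP : P <= (16 * M) ^+ (d * k.+2) * (X ^+ k.+2 * 2 ^+ d).
  by move: h1; rewrite div1r exprVn mulrC ler_pdivrMr// mulrC.
have he : expR L ^+ 2 <= 16 ^+ (d * k.+2).
  apply: le_trans (_ : expR (M * d%:R) ^+ 2 <= _).
    by rewrite lerXn2r ?nnegrE ?expR_ge0// hL ler_expR ler_wpM2r.
  rewrite /M -natrM -[_%:R]mul1r expRM_natr -exprM mulnC exprM mulnC.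
  rewrite lerXn2r ?nnegrE ?exprn_ge0 ?expR_ge0//.
  have e0 := expR_ge0 (1 : R); rewrite (_ : 16 = 4 ^+ 2 :> R); last by ring.
  by rewrite lerXn2r ?nnegrE ?expR1_le4.
have h2d : 2 ^+ d <= 2 ^+ (d * k.+2) :> R.
  by rewrite ler_weXn2l ?leq_pmulr//; lra.
have XX : 0 < X ^+ k.+2 by rewrite exprn_gt0.
rewrite -(ler_pXn2r (n := k.+2))// ?nnegrE ?(ltW X0) ?mulr_ge0 ?exprn_ge0 ?mulr_ge0 ?(ltW g0)//.
rewrite -(ler_pM2r XX).
have -> : X ^+ k.+2 * X ^+ k.+2 = X ^+ k.+2.*2 by rewrite -exprD addnn.
apply: le_trans h2 _.
have g0' : 0 <= g1 ^+ k.+1.*2 * (g1 * expR L) ^+ 2.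
  by rewrite mulr_ge0 ?sqr_ge0 ?exprn_ge0 ?(ltW g0).
apply: le_trans (ler_wpM2l g0' hP) _.
have -> : g1 ^+ k.+1.*2 * (g1 * expR L) ^+ 2 = g1 ^+ k.+2.*2 * expR L ^+ 2.
  by rewrite (doubleS k.+1) -(addn2 k.+1.*2) exprD exprMn mulrA.
rewrite (exprMn k.+2 (g1 ^+ 2)) -!exprM mul2n -mulrA -[leRHS]mulrA.
rewrite ler_wpM2l ?exprn_ge0 ?(ltW g0)//.
rewrite (_ : 512 * M = 16 * 2 * (16 * M)); last by ring.
rewrite [in leRHS]exprMn [in leRHS](exprMn _ 16).
rewrite [leRHS](_ : _ = 16 ^+ (d * k.+2) * ((16 * M) ^+ (d * k.+2) *
  (X ^+ k.+2 * 2 ^+ (d * k.+2)))); last by ring.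
apply: ler_pM => //; first exact: sqr_ge0.
  by rewrite mulr_ge0 ?(ltW W0)// mulr_ge0 ?(ltW XX) ?exprn_ge0.
by rewrite ler_wpM2l ?(ltW W0)// ler_wpM2l ?(ltW XX).
Qed.

(** With [q = 2 * k.+2%:R * r2 <= 1 / 4], the left side is [2 * k.+2%:R * q ^+ k.+1], and
    [2 * k.+2%:R <= 4 ^+ k.+1]. *)
Lemma level_coefficient_le1 (k : nat) (r2 : R) : 0 <= r2 ->
  8 * k.+2%:R * r2 <= 1 ->
  (2 * k.+2%:R) ^+ k.+2 * r2 ^+ k.+1 <= 1.
Proof.
move=> r0 hr.
rewrite exprS -mulrA -exprMn.
set q := _ * r2.
have q0 : 0 <= q by rewrite !mulr_ge0.
have hq : q <= 1 / 4 by move: hr; rewrite /q; lra.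
have : q ^+ k.+1 <= (1 / 4) ^+ k.+1 by rewrite lerXn2r ?nnegrE//; lra.
have hk : 2 * k.+2%:R <= 4 ^+ k.+1 :> R.
  rewrite -natrM -natrX ler_nat; elim: k {hr q q0 hq} => // k.
  by rewrite (expnS 4 k.+1); lia.
rewrite div1r exprVn => hqk.
apply: le_trans (_ : 4 ^+ k.+1 * (4 ^+ k.+1)^-1 <= _).
  by rewrite ler_pM ?mulr_ge0 ?exprn_ge0.
by rewrite mulfV// expf_neq0//; apply/negP => /eqP; lra.
Qed.

End LevelInequality.

Section LevelInequalityGlobal.
Variables (R : realType) (Omega : finType) (mu : Omega -> R) (n : nat).
Hypothesis mu_ge0 : forall a, 0 <= mu a.
Hypothesis mu_sum1 : \sum_(a : Omega) mu a = 1.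

Notation pt := {ffun 'I_n -> Omega}.
Notation merge := Defs.merge.
Notation Ex := (@expect R Omega mu n).
Implicit Types (S : {set 'I_n}) (f g : pt -> R) (x y : pt).

Lemma expect_norm_le_norm1 g : `|Ex g| <= norm1 mu g.
Proof.
apply: le_trans (ler_norm_sum _ _ _) _; apply: ler_sum => y _.
by rewrite normrM ger0_norm ?mun_ge0.
Qed.

Lemma Lop_eq0_const g : (forall i y, Lop mu i g y = 0) -> forall y, g y = Ex g.
Proof.
move=> hL.
have hU y i a : g (upd y i a) = g y.
  have := hL i (upd y i a); have := hL i y; rewrite /Lop Eop_upd.
  by move=> /eqP; rewrite subr_eq0 => /eqP -> /eqP; rewrite subr_eq0 => /eqP ->.
have hM S x y : g (merge S x y) = g y.
  move: {2}#|S| (erefl #|S|) => m; elim: m S => [|m IH] S.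
    by move/eqP; rewrite cards_eq0 => /eqP->; rewrite merge0.
  move=> cS; have [i iS] : exists i, i \in S by apply/card_gt0P; rewrite cS.
  rewrite -(hU _ i (x i)) -merge_upd_D1 hU IH//.
  by move: cS; rewrite (cardsD1 i) iS => -[].
move=> y; rewrite -[LHS](expect_const n mu_sum1); apply: eq_expect => z.
by rewrite -(hM setT z y) mergeT.
Qed.

Lemma level0_inequality (g1 : R) f : norm1 mu f <= g1 ->
  Ex (fun y => fdeg mu 0 f y ^+ 2) <= g1 ^+ 2.
Proof.
move=> hf.
have hc : forall y, fdeg mu 0 f y = Ex (fdeg mu 0 f).
  apply: Lop_eq0_const => i y.
  rewrite -LS1 -[LHS](_ : Dop mu [set i] y (fdeg mu 0 f) y = _).
    by rewrite Dop_fdeg_gt// cards1.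
  by congr (LS _ _ _ _); apply/ffunP => j; rewrite ffunE if_same.
move: (Ex (fdeg mu 0 f)) hc => c hc.
have e1 : Ex (fun y => fdeg mu 0 f y ^+ 2) = c ^+ 2.
  by rewrite -[RHS](expect_const n mu_sum1); apply: eq_expect => y; rewrite hc.
have e2 : Ex (fun y => f y * fdeg mu 0 f y) = c * Ex f.
  by rewrite -expectZ; apply: eq_expect => y; rewrite hc mulrC.
have := expect_fdeg mu_sum1 0 f; rewrite e1 e2 => hcf.
have he : Ex f ^+ 2 <= g1 ^+ 2.
  rewrite -(real_normK (num_real (Ex f))) lerXn2r ?nnegrE//.
    by apply: le_trans (le_trans (expect_norm_le_norm1 f) hf).
  exact: le_trans (expect_norm_le_norm1 f) hf.
(* Since [c ^+ 2 = c * Ex f], this square equals [Ex f ^+ 2 - c ^+ 2]. *)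
have := sqr_ge0 (c - Ex f); lra.
Qed.

Lemma level_inequality_of_derivatives (d : nat) (r L g1 : R) f : (0 < d)%N ->
  1 <= r -> 0 < g1 -> d%:R <= L / 2 ->
  norm1 mu f <= g1 -> norm2 mu f <= g1 * expR L ->
  let B := g1 ^+ 2 * ((33 * r) ^+ 2 * (L / d%:R)) ^+ d in
  (forall S x, S != set0 -> Ex (fun y => Dop mu S x (fdeg mu d f) y ^+ 2) <=
     (4 / 1089 * (d%:R / L)) ^+ #|S| * B) ->
  Ex (fun y => fdeg mu d f y ^+ 2) <= B.
Proof.
move=> d0 r1 g0 hdL hf1 hf2 B hS.
set X := Ex _; rewrite leNgt; apply/negP => BX.
have d0' : 0 < d%:R :> R by rewrite ltr0n.
have L0 : 0 < L by clear -d0' hdL; lra.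
set lam := L / d%:R in B BX hS.
have lam2 : 2 <= lam by rewrite ler_pdivlMr//; lra.
have B0 : 0 < B.
  by clear -g0 r1 lam2; rewrite mulr_gt0 ?exprn_gt0// mulr_gt0 ?exprn_gt0//; lra.
have X0 : 0 < X by exact: lt_trans BX.
(* The exponent [m = k.+2] is the integer part of [lam] plus one; [lam >= 2] makes it at most
   [3 / 2 * lam]. *)
have [k [lamM Mlam]] : exists k, lam <= k.+2%:R /\ k.+2%:R <= 3 / 2 * lam.
  have lam0 : 0 <= lam by clear -lam2; lra.
  have := truncn_itv lam0; have := truncn_ge_nat 2 lam0; rewrite lam2.
  case: (Num.truncn lam) => [|t]// _ /andP[h1 h2]; exists t; split.
    exact: ltW.
  by clear -h1 lam2; rewrite -natr1; lra.
set M : R := k.+2%:R in lamM Mlam.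
have M0 : 0 < M by rewrite ltr0n.
set r2 := 4 / 1089 * (d%:R / L).
have r2E : r2 = 4 / 1089 / lam by rewrite /r2 /lam; field; rewrite !gt_eqF.
have r20 : 0 <= r2 by clear -r2E lam2; rewrite r2E divr_ge0//; lra.
(* Replacing [B] by the larger [X] adds the case [S = set0], so the function is global with its own
   norm as parameter. *)
have hD S x : Ex (fun y => Dop mu S x (fdeg mu d f) y ^+ 2) <= r2 ^+ #|S| * X.
  have [->|S0] := eqVneq S set0.
    by rewrite cards0 expr0 mul1r Dop0.
  apply: le_trans (hS _ _ S0) _.
  by rewrite ler_wpM2l ?exprn_ge0// ltW.
pose rho := Num.sqrt (1 / (16 * M)).
have rho2 : rho ^+ 2 = 1 / (16 * M) by rewrite sqr_sqrtr// divr_ge0// mulr_ge0// ltW.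
have hrho : 16 * M * rho ^+ 2 <= 1.
  by rewrite rho2 div1r mulfV// gt_eqF// mulr_gt0.
have hyper := hypercontractive mu_ge0 mu_sum1 hrho r20 (ltW X0) hD.
(* Here [8 * M * r2] is at most 8 * (3 / 2) * (4 / 1089) = 48 / 1089. *)
have b1 : (2 * M) ^+ k.+2 * r2 ^+ k.+1 <= 1.
  apply: level_coefficient_le1 => //; rewrite r2E mulrA ler_pdivrMr; last first.
    by clear -lam2; lra.
  by clear -Mlam lam2; rewrite -/M; lra.
have b0 : 0 <= (2 * M) ^+ k.+2 * r2 ^+ k.+1.
  by rewrite mulr_ge0 ?exprn_ge0// mulr_ge0// ltW.
set P := Ex (fun y => fdeg mu d f y ^+ k.+2.*2).
have h1 : (1 / (16 * M)) ^+ (d * k.+2) * P <= X ^+ k.+2 * 2 ^+ d.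
  move: hyper; rewrite !noise_fdeg// (@eq_expect _ _ _ _ _ (fun y =>
     (1 / (16 * M)) ^+ (d * k.+2) * fdeg mu d f y ^+ k.+2.*2)); last first.
    move=> y; rewrite exprMn -rho2 -!exprM; congr (_ ^+ _ * _).
    by rewrite -mul2n mulnCA.
  rewrite expectZ -/P => hyp; apply: le_trans hyp _.
  rewrite (@eq_expect _ _ _ _ _ (fun y => (1 + (2 * M) ^+ k.+2 * r2 ^+ k.+1) ^+ d *
     fdeg mu d f y ^+ 2)); last by move=> y; rewrite -mulrA.
  rewrite expectZ -/X mulrCA mulrC -exprSr ler_wpM2l ?exprn_ge0 ?(ltW X0)//.
  by clear -b0 b1; rewrite lerXn2r ?nnegrE//; lra.
have h2 : X ^+ k.+2.*2 <= g1 ^+ k.+1.*2 * (g1 * expR L) ^+ 2 * P.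
  rewrite /X expect_fdeg//.
  have := @wsum_interpolation _ _ (@mun _ _ mu n) k.+1 _ f (fdeg mu d f)
    (mun_ge0 mu_ge0) g0 hf1.
  move=> hint; apply: le_trans hint _.
  rewrite -/(Ex (fun y => fdeg mu d f y ^+ _)) -/P ler_wpM2r//.
    by apply: expect_ge0 => // y; rewrite -mul2n exprM exprn_ge0// sqr_ge0.
  rewrite ler_wpM2l ?exprn_ge0 ?(ltW g0)//.
  by rewrite -norm2_le// mulr_ge0 ?expR_ge0 ?(ltW g0).
have hL : L = lam * d%:R by rewrite /lam mulfVK// gt_eqF.
have := level_conclusion X0 g0 hL lamM h1 h2; apply/negP; rewrite -ltNge.
apply: le_lt_trans BX; rewrite ler_wpM2l ?sqr_ge0//.
clear -r1 M0 Mlam lam2; rewrite lerXn2r ?nnegrE//.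
- by rewrite mulr_ge0// ltW.
- by rewrite mulr_ge0 ?sqr_ge0//; lra.
(* This is where 33 comes from: [512 * M <= 768 * lam], and 33 squared is 1089. *)
apply: le_trans (_ : 33 ^+ 2 * lam <= _); first by rewrite -/M; lra.
rewrite ler_wpM2r//; first by lra.
by rewrite lerXn2r ?nnegrE//; lra.
Qed.

Lemma expect_Dop_fdeg (d : nat) (r L g1 : R) f S x : 1 <= r -> 0 < L ->
  (#|S| <= d)%N ->
  Ex (fun y => fdeg mu (d - #|S|) (Dop mu S x f) y ^+ 2) <=
    (r ^+ #|S| * g1) ^+ 2 *
    ((33 * r) ^+ 2 * (L / (d - #|S|)%:R)) ^+ (d - #|S|) ->
  Ex (fun y => Dop mu S x (fdeg mu d f) y ^+ 2) <=
    (4 / 1089 * (d%:R / L)) ^+ #|S| *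
    (g1 ^+ 2 * ((33 * r) ^+ 2 * (L / d%:R)) ^+ d).
Proof.
move=> r1 L0 Sd; rewrite (@eq_expect _ _ _ _ (fun y => Dop _ _ _ _ _ ^+ 2)
   (fun y => fdeg mu (d - #|S|) (Dop mu S x f) y ^+ 2)); last first.
  by move=> y; rewrite Dop_fdeg_le.
move=> hyp; apply: le_trans hyp _.
have := level_radius_gain (d - #|S|) #|S| r1 L0; rewrite subnK// => hg.
rewrite exprMn mulrAC mulrC [leRHS]mulrCA.
by rewrite ler_wpM2l ?sqr_ge0.
Qed.

Lemma level_inequality (r L : R) : 1 <= r -> 0 < L ->
  forall (d : nat) (g1 : R) f, 0 < g1 -> d%:R <= L / 2 ->
  global1d mu r g1 d f -> global2d mu r (g1 * expR L) d f ->
  Ex (fun y => fdeg mu d f y ^+ 2) <=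
    g1 ^+ 2 * ((33 * r) ^+ 2 * (L / d%:R)) ^+ d.
Proof.
move=> r1 L0; elim/ltn_ind => d IH g1 f g0 hdL hf1 hf2.
have r0 : 0 < r by lra.
(* Globalness at [set0] still asks for a base point; without points the expectation is an empty
   sum. *)
have [y0|nopt] := pickP (@predT pt); last first.
  rewrite /expect big_pred0; last by move=> y; have := nopt y.
  rewrite mulr_ge0 ?sqr_ge0// exprn_ge0// mulr_ge0 ?sqr_ge0// divr_ge0//; lra.
move=> _.
have n1 : norm1 mu f <= g1.
  by have := hf1 set0 y0; rewrite cards0 expr0 mul1r Dop0; apply.
have n2 : norm2 mu f <= g1 * expR L.
  by have := hf2 set0 y0; rewrite cards0 expr0 mul1r Dop0; apply.
have [d0|d0] := posnP d.
  by rewrite d0 expr0 mulr1; apply: level0_inequality.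
apply: level_inequality_of_derivatives => // S x S0.
have [Sd|dS] := leqP #|S| d; last first.
  rewrite (@eq_expect _ _ _ _ _ (fun=> 0)); last first.
    by move=> y; rewrite Dop_fdeg_gt// expr0n.
  by rewrite expect_const// ?(sqr_ge0, exprn_ge0, mulr_ge0, invr_ge0, ltW L0)//.
apply: expect_Dop_fdeg => //.
have s0 : (0 < #|S|)%N by rewrite card_gt0.
(* Passing to [Dop mu S x f] multiplies both parameters by [r ^+ #|S|], so their ratio, and with it
   [L], is unchanged while the level drops. *)
apply: IH.
- by rewrite ltn_subrL s0 d0.
- by rewrite mulr_gt0 ?exprn_gt0.
- by apply: le_trans hdL; rewrite ler_nat leq_subr.
- exact: global1d_Dop (ltW r0) (ltW g0) Sd hf1.
have gL : 0 <= g1 * expR L by rewrite mulr_ge0 ?expR_ge0 ?(ltW g0).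
by rewrite -mulrA; exact: global2d_Dop (ltW r0) gL Sd hf2.
Qed.

End LevelInequalityGlobal.

(** * From the level inequality to globalness of the degree-d part *)

Theorem mainTheorem7 (R : realType) (Omega : finType) (mu : Omega -> R)
  (mu_ge0 : forall a, 0 <= mu a) (mu_sum1 : \sum_(a : Omega) mu a = 1)
  (n : nat) (r gamma1 gamma2 : R) (d : nat)
  (f : {ffun 'I_n -> Omega} -> R) :
  1 <= r -> 0 < gamma1 -> gamma1 < gamma2 ->
  d%:R <= ln (gamma2 / gamma1) / 2 ->
  global1d mu r gamma1 d f ->
  global2d mu r gamma2 d f ->
  global2 mu (Num.sqrt d%:R / Num.sqrt (ln (gamma2 / gamma1)))
    ((33 * r / Num.sqrt d%:R) ^+ d * gamma1 * Num.sqrt (ln (gamma2 / gamma1)) ^+ d)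
    (fdeg mu d f).
Proof.
move=> r1 g0 g12; set L := ln _ => hdL hf1 hf2 S x.
have L0 : 0 < L by apply: ln_gt0; rewrite ltr_pdivlMr// mul1r.
have g2E : gamma2 = gamma1 * expR L.
  rewrite /L lnK ?posrE; first by rewrite mulrC mulfVK ?gt_eqF.
  by rewrite divr_gt0//; exact: lt_trans g12.
have s0 : 0 <= Num.sqrt d%:R / Num.sqrt L by rewrite divr_ge0 ?sqrtr_ge0.
have r0 : 0 <= 33 * r by lra.
rewrite norm2_le//; last first.
  by rewrite !mulr_ge0 ?exprn_ge0 ?divr_ge0 ?sqrtr_ge0// ltW.
have [Sd|dS] := leqP #|S| d; last first.
  rewrite (@eq_expect _ _ _ _ _ (fun=> 0)); last first.
    by move=> y; rewrite Dop_fdeg_gt// expr0n.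
  by rewrite expect_const// sqr_ge0.
have hS : expect mu (fun y => Dop mu S x (fdeg mu d f) y ^+ 2) <=
    (4 / 1089 * (d%:R / L)) ^+ #|S| *
    (gamma1 ^+ 2 * ((33 * r) ^+ 2 * (L / d%:R)) ^+ d).
  rewrite g2E in hf2.
  apply: expect_Dop_fdeg => //.
  apply: (level_inequality mu_ge0 mu_sum1 r1 L0).
  - by rewrite mulr_gt0 ?exprn_gt0//; lra.
  - by apply: le_trans hdL; rewrite ler_nat leq_subr.
  - by apply: global1d_Dop => //; lra.
  have gL : 0 <= gamma1 * expR L by rewrite mulr_ge0 ?expR_ge0 ?(ltW g0).
  by rewrite -mulrA; apply: global2d_Dop gL Sd hf2 => //; lra.
apply: le_trans hS _.
(* Squaring removes the roots. For [d = 0] the quotients by zero occur only under exponent 0. *)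
have -> : ((Num.sqrt d%:R / Num.sqrt L) ^+ #|S| *
    ((33 * r / Num.sqrt d%:R) ^+ d * gamma1 * Num.sqrt L ^+ d)) ^+ 2 =
    (d%:R / L) ^+ #|S| * (gamma1 ^+ 2 * ((33 * r) ^+ 2 * (L / d%:R)) ^+ d).
  have sqrE u v w : (u ^+ #|S| * (v ^+ d * gamma1 * w ^+ d)) ^+ 2 =
      (u ^+ 2) ^+ #|S| * (gamma1 ^+ 2 * (v ^+ 2 * w ^+ 2) ^+ d).
    rewrite (exprMn d (v ^+ 2)) (exprAC u 2) (exprAC v 2) (exprAC w 2).
    by move: (u ^+ _) (v ^+ _) (w ^+ _) => u' v' w'; ring.
  rewrite sqrE !expr_div_n !sqr_sqrtr ?(ltW L0)//.
  by congr (_ * (_ * _ ^+ _)); rewrite mulrAC mulrA.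
rewrite ler_wpM2r//.
  by rewrite mulr_ge0 ?sqr_ge0// exprn_ge0// mulr_ge0 ?sqr_ge0// divr_ge0// ltW.
(* The factor 4 / 1089 per derivative is simply discarded. *)
have : 0 <= d%:R / L by rewrite divr_ge0 ?(ltW L0).
by move: (d%:R / L) => t t0; apply: lerXn2r; rewrite ?nnegrE; lra.
Qed.
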